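(* Let $n\ge 1$. (I) Let $R=(r_1,\dots,r_n)$ and $S=(s_1,\dots,s_n)$ be vectors of nonnegative real numbers with $\sum_i r_i=\sum_j s_j$. Then $\mathcal{T}^{4}(R,S)\neq\emptyset$ if and only if (a) $R=S$, and (b) $R$ is palindromic, i.e. $r_i=r_{n+1-i}$ for all $i$. (II) Suppose in addition that $R$ and $S$ have nonnegative integer components. Then $\mathcal{T}^{4}_{\mathbb{Z}}(R,S)\neq\emptyset$ if and only if (a) and (b) hold as well as (c) if $n$ is even then every component of $R$ is even, and if $n$ is odd then $r_{\lceil n/2\rceil}\ge o(R)$, where $o(R)$ is the number of odd components of $R$.
   Context: $\mathcal{T}(R,S)$ is the set of $n\times n$ matrices with nonnegative real entries whose $i$th row sum is $r_i$ and whose $j$th column sum is $s_j$ for all $i,j$. The dihedral group $D_4$ of the square (of order $8$) acts on $n\times n$ matrices by rotations and reflections of the square array; it is generated by the transposition $A\mapsto A^t$ and the reflection $(r_\infty A)_{i,j}=a_{i,\,n+1-j}$. $\mathcal{T}^{4}(R,S)$ is the set of $A\in\mathcal{T}(R,S)$ fixed by every element of $D_4$; $\mathcal{T}^{4}_{\mathbb{Z}}(R,S)$ is the set of those $A\in\mathcal{T}^{4}(R,S)$ all of whose entries are integers. *)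

(* Defs.v *)
From HB Require Import structures.
From mathcomp Require Import all_boot all_order all_algebra all_fingroup.
From mathcomp Require Import classical_sets reals.

Set Implicit Arguments.
Unset Strict Implicit.
Unset Printing Implicit Defensive.

Import Order.TTheory GRing.Theory Num.Theory.

Local Open Scope ring_scope.

Section TransportationClass.
Local Open Scope classical_set_scope.
Variables (K : realType) (n : nat).
Implicit Types (R S : 'rV[K]_n) (A : 'M[K]_n).

Definition calT R S : set 'M[K]_n :=
  [set A | [/\ forall i j, 0 <= A i j,
               forall i, \sum_j A i j = R 0 i &
               forall j, \sum_i A i j = S 0 j]].

End TransportationClass.

Section Dihedral.
Variable n : nat.

Definition transpose_pos (p : 'I_n * 'I_n) : 'I_n * 'I_n := (p.2, p.1).

Definition reflect_pos (p : 'I_n * 'I_n) : 'I_n * 'I_n := (p.1, rev_ord p.2).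

Lemma transpose_pos_inj : injective transpose_pos.
Proof. by case=> i j [i' j'] [-> ->]. Qed.

Lemma reflect_pos_inj : injective reflect_pos.
Proof.
move=> [i j] [i' j'] eq_p; have /= -> := congr1 fst eq_p.
by have /= /rev_ord_inj -> := congr1 snd eq_p.
Qed.

(* The dihedral group of the square, realised as the group of permutations of
   the n * n positions of the array that it induces. For n > 1 this group has
   order 8; for n = 1 the action of the dihedral group is trivial. *)
Definition D4 : {group {perm 'I_n * 'I_n}} :=
  <<[set perm transpose_pos_inj; perm reflect_pos_inj]>>%G.

(* The entry of A at position p is moved to position g p. *)
Definition D4_act (T : Type) (A : 'M[T]_n) (g : {perm 'I_n * 'I_n}) : 'M[T]_n :=
  \matrix_(i, j) A ((g^-1)%g (i, j)).1 ((g^-1)%g (i, j)).2.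

Lemma D4_act_transpose (T : Type) (A : 'M[T]_n) :
  D4_act A (perm transpose_pos_inj) = A^T.
Proof.
apply/matrixP => i j; rewrite !mxE.
have -> : ((perm transpose_pos_inj)^-1)%g (i, j) = (j, i).
  by apply: (canLR (permK _)); rewrite permE.
by [].
Qed.

Lemma D4_act_reflect (T : Type) (A : 'M[T]_n) (i j : 'I_n) :
  D4_act A (perm reflect_pos_inj) i j = A i (rev_ord j).
Proof.
rewrite !mxE.
have -> : ((perm reflect_pos_inj)^-1)%g (i, j) = (i, rev_ord j).
  by apply: (canLR (permK _)); rewrite permE /reflect_pos /= rev_ordK.
by [].
Qed.

End Dihedral.

Section SymmetricClasses.
Local Open Scope classical_set_scope.
Variables (K : realType) (n : nat).
Implicit Types (R S : 'rV[K]_n) (A : 'M[K]_n).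

Definition calT4 R S : set 'M[K]_n :=
  [set A | calT R S A /\ (forall g, g \in D4 n -> D4_act A g = A)].

Definition calT4Z R S : set 'M[K]_n :=
  [set A | calT4 R S A /\ (forall i j, A i j \is a Num.int)].

Definition palindromic R := forall i, R 0 i = R 0 (rev_ord i).

(* Parity of a real number that is a natural number, for which Num.truncn is
   the inverse of the cast from nat; only meaningful for such reals. *)
Definition odd_nat (x : K) : bool := odd (Num.truncn x).

Lemma odd_nat_natr (k : nat) : odd_nat k%:R = odd k.
Proof. by rewrite /odd_nat natrK. Qed.

Definition num_odd R : nat := #|[pred i | odd_nat (R 0 i)]|.

End SymmetricClasses.

Lemma middle_subproof n : (0 < n)%N -> ((uphalf n).-1 < n)%N.
Proof.
case: n => // n _; rewrite uphalfE /= ltnS.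
by rewrite -{2}(odd_double_half n) -addnn addnA leq_addl.
Qed.

(* The ceil(n/2)-th index, counting from 1, that is (uphalf n).-1 from 0. *)
Definition middle n (n_gt0 : (0 < n)%N) : 'I_n :=
  Ordinal (middle_subproof n_gt0).

(* Main.v *)
(* An invariant matrix is a symmetric matrix with palindromic rows, so its
   row sums equal its column sums and are palindromic.  Conversely, spreading
   each r_i evenly over the positions (i, i) and (i, n + 1 - i) gives an
   invariant matrix, which is integral when every r_i is even and n is even.
   In an integral invariant matrix the entries of a row pair up under
   j |-> n + 1 - j, so the parity of r_i is that of the middle entry of row i
   (0 if n is even); the odd middle entries all contribute to the middle column
   sum.  For the converse with n odd, put the parities of the r_i on the middle
   row and column, correct the central entry, and spread the even remainders
   over the two diagonals. *)
Require Import Defs.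
From HB Require Import structures.
From mathcomp Require Import all_boot all_order all_algebra all_fingroup.
From mathcomp Require Import classical_sets reals.
From mathcomp Require Import zify ring lra.

Set Implicit Arguments.
Unset Strict Implicit.
Unset Printing Implicit Defensive.

Import Order.TTheory GRing.Theory Num.Theory.

Local Open Scope classical_set_scope.
Local Open Scope ring_scope.


(** * The action of the dihedral group and its invariants *)

Lemma D4_act1 (T : Type) n (A : 'M[T]_n) : D4_act A 1%g = A.
Proof. by apply/matrixP => i j; rewrite mxE invg1 perm1. Qed.

Lemma D4_actM (T : Type) n (A : 'M[T]_n) (g h : {perm 'I_n * 'I_n}) :
  D4_act A (g * h)%g = D4_act (D4_act A g) h.
Proof. by apply/matrixP => i j; rewrite !mxE invMg permM -surjective_pairing. Qed.

(** The stabiliser of [A] is a subgroup, so it contains [D4 n] as soon as it contains the two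
    generators. *)
Lemma D4_invariantP (T : eqType) n (A : 'M[T]_n) :
  (forall g, g \in D4 n -> D4_act A g = A) <->
  A^T = A /\ forall i j, A i (rev_ord j) = A i j.
Proof.
split=> [inv | [symA revA] g gD].
  split=> [|i j].
    by rewrite -[LHS]D4_act_transpose inv // mem_gen // !inE eqxx.
  by rewrite -[LHS]D4_act_reflect inv // mem_gen // !inE eqxx orbT.
pose H := [set h | D4_act A h == A]%SET.
have gH : group_set H.
  apply/group_setP; split=> [|x y]; first by rewrite inE D4_act1.
  by rewrite !inE D4_actM => /eqP-> /eqP->.
suff sDH : D4 n \subset Group gH by have := fintype.subsetP sDH g gD; rewrite inE => /eqP.
rewrite gen_subG; apply/fintype.subsetP => x; rewrite !inE => /orP[] /eqP->.
  by rewrite D4_act_transpose symA.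
by apply/eqP/matrixP => i j; rewrite D4_act_reflect revA.
Qed.

(** * Index reversal and the parity of palindromic sums *)

Lemma rev_ord_fixed n (n_gt0 : (0 < n)%N) (i : 'I_n) :
  (rev_ord i == i) = odd n && (i == middle n_gt0).
Proof.
rewrite -!val_eqE /= uphalfE; have := odd_double_half n.+1; have := ltn_ord i.
rewrite /=; case: (odd n) => /=; lia.
Qed.

(** Reversal exchanges the indices before and after the centre, so these contribute an even amount;
    only a fixed index, which exists exactly for odd [n], affects the parity. *)
Lemma odd_sum_palindrome n (n_gt0 : (0 < n)%N) (f : 'I_n -> nat) :
  (forall i, f (rev_ord i) = f i) ->
  odd (\sum_i f i)%N = odd n && odd (f (middle n_gt0)).
Proof.
move=> revf.
rewrite (bigID (fun i : 'I_n => i < rev_ord i)%N) /=.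
rewrite [X in (_ + X)%N](bigID (fun i : 'I_n => rev_ord i == i)) /=.
have -> : (\sum_(i < n | ~~ (i < n - i.+1)%N && (rev_ord i != i)) f i
           = \sum_(i < n | (i < n - i.+1)%N) f i)%N.
  rewrite (reindex_inj rev_ord_inj) /=; apply: eq_big => [i|i _]; last exact: revf.
  by rewrite -val_eqE /=; have := ltn_ord i; lia.
rewrite addnCA addnn oddD odd_double addbF.
case: (boolP (odd n)) => /= oddn.
  rewrite (big_pred1 (middle n_gt0)) // => i.
  rewrite (rev_ord_fixed n_gt0) oddn /=.
  case: eqP => [->|_]; last by rewrite andbF.
  have /eqP/(congr1 (@nat_of_ord n))/= -> :
      rev_ord (middle n_gt0) == middle n_gt0.
    by rewrite rev_ord_fixed oddn eqxx.
  by rewrite ltnn.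
by rewrite big_pred0 // => i; rewrite (rev_ord_fixed n_gt0) (negPf oddn) andbF.
Qed.

(** * Margins of invariant matrices, and matrices on the two diagonals *)

Section TwoDiagonals.
Variables (K : realType) (n : nat).
Implicit Types (d R S : 'rV[K]_n) (A : 'M[K]_n).

Lemma calT4_of_sym_rev R A :
  (forall i j, 0 <= A i j) -> (forall i, \sum_j A i j = R 0 i) ->
  A^T = A -> (forall i j, A i (rev_ord j) = A i j) -> calT4 R R A.
Proof.
move=> A_ge0 rowA symA revA; split; last exact/D4_invariantP.
split=> // j; rewrite -rowA; apply: eq_bigr => i _.
by rewrite -{1}symA mxE.
Qed.

Lemma calT4_margins R S A : calT4 R S A -> R = S /\ palindromic R.
Proof.
move=> [[_ rowA colA] /D4_invariantP[symA revA]]; split.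
  apply/rowP => i; rewrite -rowA -colA.
  by apply: eq_bigr => j _; rewrite -{1}symA mxE.
(* Symmetry turns invariance under column reversal into invariance under row reversal. *)
move=> i; rewrite -!rowA; apply: eq_bigr => j _.
by rewrite -symA !mxE revA.
Qed.

Lemma sum_indicator (k : 'I_n) (F : 'I_n -> K) :
  \sum_j (j == k)%:R * F j = F k.
Proof.
rewrite (bigD1 k) //= eqxx mul1r big1 ?addr0 // => j /negPf->.
by rewrite mul0r.
Qed.

(** The two indicators are added, so where the diagonals meet, at the centre for odd [n], the entry
    is the full [d 0 i] and the row sum is still right. *)
Definition two_diag_mx d : 'M[K]_n :=
  \matrix_(i, j) ((j == i)%:R * (d 0 i / 2) + (j == rev_ord i)%:R * (d 0 i / 2)).

Lemma two_diag_mx_ge0 d i j : 0 <= d 0 i -> 0 <= two_diag_mx d i j.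
Proof. by move=> d_ge0; rewrite mxE addr_ge0 ?mulr_ge0 ?invr_ge0 ?ler0n. Qed.

Lemma two_diag_mx_row d i : \sum_j two_diag_mx d i j = d 0 i.
Proof.
under eq_bigr do rewrite mxE.
by rewrite big_split /= !sum_indicator -splitr.
Qed.

Lemma two_diag_mx_rev d i j :
  two_diag_mx d i (rev_ord j) = two_diag_mx d i j.
Proof.
by rewrite !mxE (inj_eq rev_ord_inj) (inv_eq (@rev_ordK n)) addrC.
Qed.

Lemma two_diag_mx_sym d : palindromic d -> (two_diag_mx d)^T = two_diag_mx d.
Proof.
move=> pal_d; apply/matrixP => i j; rewrite !mxE (eq_sym j i).
rewrite -(inv_eq (@rev_ordK n)) (eq_sym (rev_ord i)); congr (_ + _).
  by case: eqP => [->|]; rewrite ?mul0r.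
by case: eqP => [->|]; rewrite ?mul0r // -pal_d.
Qed.

Lemma two_diag_mx_calT4 R :
  (forall i, 0 <= R 0 i) -> palindromic R -> calT4 R R (two_diag_mx R).
Proof.
move=> R_ge0 palR; apply: calT4_of_sym_rev.
- by move=> i j; apply: two_diag_mx_ge0.
- exact: two_diag_mx_row.
- exact: two_diag_mx_sym.
- exact: two_diag_mx_rev.
Qed.

Lemma two_diag_mx_int d i j :
  d 0 i / 2 \is a Num.int -> two_diag_mx d i j \is a Num.int.
Proof.
by move=> d_int; rewrite mxE; do !case: eqP => _;
  rewrite ?mul0r ?mul1r ?addr0 ?add0r ?rpredD ?rpred0.
Qed.

(** * Matrices on the middle row and column *)

Definition cross_mx (m : 'I_n) d : 'M[K]_n :=
  \matrix_(i, j) ((i == m)%:R * d 0 j + (j == m)%:R * d 0 i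
                  - (j == m)%:R * ((i == m)%:R * \sum_k d 0 k)).

(** Outside row [m] the only possibly nonzero entry is [d 0 i] in column [m]. Row [m] carries all of
    [d] and a second [d 0 m], and the central correction removes the total of [d]; the centre may
    thus be negative. *)
Lemma cross_mx_row m d i : \sum_j cross_mx m d i j = d 0 i.
Proof.
under eq_bigr do rewrite mxE.
by rewrite sumrB big_split /= -mulr_sumr !sum_indicator addrC addrK.
Qed.

Lemma cross_mx_sym m d : (cross_mx m d)^T = cross_mx m d.
Proof. by apply/matrixP => i j; rewrite !mxE; ring. Qed.

Lemma cross_mx_rev m d i j : rev_ord m = m -> palindromic d ->
  cross_mx m d i (rev_ord j) = cross_mx m d i j.
Proof.
by move=> revm pal_d; rewrite !mxE -pal_d (inv_eq (@rev_ordK n)) revm.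
Qed.

Lemma cross_mx_int m d i j :
  (forall k, d 0 k \is a Num.int) -> cross_mx m d i j \is a Num.int.
Proof.
move=> d_int; rewrite mxE.
by rewrite rpredB ?rpredD ?rpredM ?rpred_sum ?rpred_nat.
Qed.

(** * Integral matrices and parities *)

Definition parity_row R : 'rV[K]_n := \row_i (odd_nat (R 0 i))%:R.

Lemma sum_parity_row R : \sum_i parity_row R 0 i = (num_odd R)%:R.
Proof.
under eq_bigr do rewrite mxE.
rewrite -natr_sum /num_odd -sum1_card [in RHS]big_mkcond /=.
by congr _%:R; apply: eq_bigr => i _; rewrite inE; case: odd_nat.
Qed.

(** Removing the parity leaves twice the integer half, which makes the diagonal part both integral
    and nonnegative. *)
Lemma half_sub_parity R i : R 0 i \is a Num.nat ->
  (R - parity_row R) 0 i / 2 = (Num.truncn (R 0 i))./2%:R.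
Proof.
move=> /natrP[k Rk]; rewrite !mxE Rk odd_nat_natr natrK.
rewrite -{1}(odd_double_half k) natrD addrAC subrr add0r -muln2 natrM.
by rewrite mulfK ?pnatr_eq0.
Qed.

Lemma palindromic_parity_row R : palindromic R -> palindromic (parity_row R).
Proof. by move=> palR i; rewrite !mxE -palR. Qed.

Lemma calT4Z_exists_odd (n_gt0 : (0 < n)%N) R :
  (forall i, R 0 i \is a Num.nat) -> palindromic R -> odd n ->
  (num_odd R)%:R <= R 0 (middle n_gt0) -> calT4Z R R !=set0.
Proof.
move=> R_nat palR oddn le_odd; set m := middle n_gt0 in le_odd.
have revm : rev_ord m = m by apply/eqP; rewrite rev_ord_fixed oddn eqxx.
have pal_par := palindromic_parity_row palR.
have pal_half : palindromic (R - parity_row R).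
  by move=> i; rewrite !mxE -palR.
exists (two_diag_mx (R - parity_row R) + cross_mx m (parity_row R)).
split; last first.
  move=> i j; rewrite mxE rpredD ?two_diag_mx_int //.
    by rewrite half_sub_parity ?rpred_nat.
  by apply: cross_mx_int => k; rewrite mxE rpred_nat.
have diag_ge0 i : 0 <= (R - parity_row R) 0 i.
  by rewrite -(@pmulr_lge0 _ 2^-1) ?invr_gt0 ?ltr0n // half_sub_parity.
apply: calT4_of_sym_rev.
- move=> i j; rewrite mxE.
  have [/andP[/eqP-> /eqP->]|] := boolP ((i == m) && (j == m)).
    (* With [p] the parity of [R 0 m], the central entry is [(R 0 m - p) + 2 p - num_odd R], that is
       [R 0 m + p - num_odd R]; this is where [le_odd] enters. *)
    rewrite !mxE sum_parity_row revm !eqxx !mul1r.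
    have : 0 <= (odd_nat (R 0 m))%:R :> K by [].
    lra.
  (* Off the centre the negative correction vanishes, and both summands are nonnegative. *)
  move=> ijm; rewrite addr_ge0 ?two_diag_mx_ge0 // !mxE.
  by case: eqP ijm => _; case: eqP => _ // _;
    rewrite ?(mul0r, mul1r, addr0, add0r, oppr0) ?ler0n.
- move=> i; under eq_bigr do rewrite mxE.
  by rewrite big_split /= two_diag_mx_row cross_mx_row !mxE subrK.
- by rewrite linearD /= two_diag_mx_sym // cross_mx_sym.
- move=> i j; rewrite mxE [RHS]mxE two_diag_mx_rev.
  by congr (_ + _); apply: cross_mx_rev.
Qed.

Lemma calT4Z_exists_even R :
  (forall i, R 0 i \is a Num.nat) -> palindromic R ->
  (forall i, ~~ odd_nat (R 0 i)) -> calT4Z R R !=set0.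
Proof.
move=> R_nat palR evenR; exists (two_diag_mx R); split.
  by apply: two_diag_mx_calT4 => // i; rewrite natr_ge0.
move=> i j; apply: two_diag_mx_int.
(* All parities are zero here, so [R] is its own even remainder. *)
have := half_sub_parity (R_nat i); rewrite !mxE (negPf (evenR i)) subr0 => ->.
by rewrite rpred_nat.
Qed.

Lemma calT4Z_parity (n_gt0 : (0 < n)%N) R S A :
  calT4Z R S A ->
  (~~ odd n -> forall i, ~~ odd_nat (R 0 i)) /\
  (odd n -> (num_odd R)%:R <= R 0 (middle n_gt0)).
Proof.
move=> [[[A_ge0 rowA _] /D4_invariantP[symA revA]] A_int].
have {A_int} A_nat i j : A i j = (Num.truncn (A i j))%:R.
  by rewrite truncnK // natrEint A_int A_ge0.
have rowN i : R 0 i = (\sum_j Num.truncn (A i j))%N%:R.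
  by rewrite -rowA natr_sum; apply: eq_bigr.
have oddR i : odd_nat (R 0 i)
    = odd n && odd (Num.truncn (A i (middle n_gt0))).
  rewrite rowN odd_nat_natr odd_sum_palindrome // => j.
  by rewrite revA.
split=> [/negPf evenn i | oddn]; first by rewrite oddR evenn.
rewrite rowN ler_nat /num_odd -sum1_card big_mkcond /=.
apply: leq_sum => i _; rewrite inE oddR oddn /=.
(* Symmetry lets the middle row be read as the middle column; each odd entry there is at least 1,
   and these odd entries mark the odd components of [R]. *)
rewrite -[A in leqRHS]symA mxE.
by case: (Num.truncn _) => // k; case: odd.
Qed.

End TwoDiagonals.

Theorem theorem18 (K : realType) (n : nat) (n_gt0 : (0 < n)%N)
    (R S : 'rV[K]_n)
    (R_ge0 : forall i, 0 <= R 0 i) (S_ge0 : forall j, 0 <= S 0 j)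
    (sumRS : \sum_i R 0 i = \sum_j S 0 j) :
  (calT4 R S !=set0 <-> R = S /\ palindromic R)
  /\
  ((forall i, R 0 i \is a Num.nat) -> (forall j, S 0 j \is a Num.nat) ->
   (calT4Z R S !=set0 <->
    [/\ R = S,
        palindromic R &
        (~~ odd n -> forall i, ~~ odd_nat (R 0 i)) /\
        (odd n -> (num_odd R)%:R <= R 0 (middle n_gt0))])).
Proof.
split.
  split=> [[A /calT4_margins //]|[<- palR]].
  by exists (two_diag_mx R); apply: two_diag_mx_calT4.
move=> R_nat _; split=> [[A AT]|[<- palR [evenR oddR]]].
  by have [eqRS palR] := calT4_margins AT.1; split=> //; apply: calT4Z_parity AT.
have [oddn|evenn] := boolP (odd n).
  by apply: calT4Z_exists_odd (oddR oddn).
exact: calT4Z_exists_even (evenR evenn).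
Qed.
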